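(* Let $n\ge1$ and $f(x)=\tfrac12 x^\top A x+b^\top x+c$ on $\mathbb{R}^{n+1}$ with $A$ symmetric positive definite, and let $x^\star=-A^{-1}b$ be its minimizer. For any $x$ with $\nabla f(x)\ne0$, an exact line search along the affine normal direction $d_{\mathrm{AN}}(x)$ reaches $x^\star$ in one step; that is, if $\alpha^\ast\in\arg\min_{\alpha\ge0}f(x+\alpha\,d_{\mathrm{AN}}(x))$, then $x+\alpha^\ast d_{\mathrm{AN}}(x)=x^\star$.
   Context: Affine normal direction: at a point $x$ with $\nabla f(x)\neq0$ put $e_{n+1}=\nabla f(x)/\|\nabla f(x)\|$ and let $e_1,\dots,e_n$ be an orthonormal basis of $\nabla f(x)^\perp$. For $i,j,p,q\in\{1,\dots,n\}$ write $f_{ij}=D^2f(x)[e_i,e_j]$, $f_{n+1,i}=D^2f(x)[e_{n+1},e_i]$, $f_{pqi}=D^3f(x)[e_p,e_q,e_i]$, and let $(f^{ij})$ be the inverse matrix of $(f_{ij})_{1\le i,j\le n}$. Then $d_{\mathrm{AN}}(x)$ is, up to a positive scalar, $$\sum_{i=1}^n\Big(\sum_{j=1}^n f^{ij}\Big(-\tfrac{1}{n+2}\|\nabla f(x)\|\sum_{p,q=1}^n f^{pq}f_{pqj}+f_{n+1,j}\Big)\Big)e_i-e_{n+1}.$$ *)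

(* Defs.v *)
From HB Require Import structures.
From mathcomp Require Import all_boot all_order all_algebra.
From mathcomp Require Import all_classical all_reals all_analysis.

Set Implicit Arguments.
Unset Strict Implicit.
Unset Printing Implicit Defensive.

Import Order.TTheory GRing.Theory Num.Theory.
Import numFieldNormedType.Exports.

Local Open Scope ring_scope.

(* Vectors of R^m are columns. The norm that the library puts on matrices is
   the sup norm; it only provides the topology used by the directional
   derivatives 'D_v. The Euclidean structure is the one defined here. *)

Definition dotv (R : realType) (m : nat) (u v : 'cV[R]_m) : R :=
  (u^T *m v) 0 0.

Definition enorm (R : realType) (m : nat) (u : 'cV[R]_m) : R :=
  Num.sqrt (dotv u u).

Definition posdefmx (R : realType) (m : nat) (A : 'M[R]_m) : Prop :=
  forall u : 'cV[R]_m, u != 0 -> 0 < (u^T *m A *m u) 0 0.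

Definition grad (R : realType) (m : nat) (f : 'cV[R]_m -> R) (x : 'cV[R]_m) :
    'cV[R]_m :=
  \col_i 'D_(delta_mx i 0) f x.

(* D^2 f(x)[u, v] and D^3 f(x)[u, v, w] as iterated directional derivatives. *)
Definition D2 (R : realType) (m : nat) (f : 'cV[R]_m -> R) (x u v : 'cV[R]_m) :
    R :=
  'D_u ('D_v f) x.

Definition D3 (R : realType) (m : nat) (f : 'cV[R]_m -> R)
    (x u v w : 'cV[R]_m) : R :=
  'D_u ('D_v ('D_w f)) x.

(* The hyperplane { v | g^T v = 0 }. *)
Definition perp (R : realType) (m : nat) (g : 'cV[R]_m) : {vspace 'cV[R]_m} :=
  lker (linfun (mulmx g^T : 'cV[R]_m -> 'M[R]_(1, 1))).

Definition orthonormal_basis (R : realType) (m n : nat)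
    (U : {vspace 'cV[R]_m}) (e : n.-tuple 'cV[R]_m) : Prop :=
  basis_of U e /\
  forall i j : 'I_n, dotv (tnth e i) (tnth e j) = (i == j)%:R.

Definition unit_normal (R : realType) (n : nat) (f : 'cV[R]_n.+1 -> R)
    (x : 'cV[R]_n.+1) : 'cV[R]_n.+1 :=
  (enorm (grad f x))^-1 *: grad f x.

Definition tangent_hessian (R : realType) (n : nat) (f : 'cV[R]_n.+1 -> R)
    (x : 'cV[R]_n.+1) (e : n.-tuple 'cV[R]_n.+1) : 'M[R]_n :=
  \matrix_(i < n, j < n) D2 f x (tnth e i) (tnth e j).

(* The matrix F below is (f^ij). It is the inverse of the tangential Hessian
   only where the latter is invertible: invmx is the identity elsewhere. *)
Definition affine_normal_vector (R : realType) (n : nat)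
    (f : 'cV[R]_n.+1 -> R) (x : 'cV[R]_n.+1) (e : n.-tuple 'cV[R]_n.+1) :
    'cV[R]_n.+1 :=
  let F := invmx (tangent_hessian f x e) in
  \sum_(i < n)
     (\sum_(j < n) F i j *
        (- (n.+2%:R)^-1 * enorm (grad f x) *
           (\sum_(p < n) \sum_(q < n)
               F p q * D3 f x (tnth e p) (tnth e q) (tnth e j))
         + D2 f x (unit_normal f x) (tnth e j)))
     *: tnth e i
  - unit_normal f x.

(* The affine normal direction is defined up to a positive scalar and through
   an arbitrary orthonormal basis of the tangent hyperplane, hence a
   predicate on d. *)
Definition affine_normal_direction (R : realType) (n : nat)
    (f : 'cV[R]_n.+1 -> R) (x d : 'cV[R]_n.+1) : Prop :=
  exists (e : n.-tuple 'cV[R]_n.+1) (t : R),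
    [/\ orthonormal_basis (perp (grad f x)) e,
        0 < t & d = t *: affine_normal_vector f x e].

Definition exact_line_search (R : realType) (m : nat) (f : 'cV[R]_m -> R)
    (x d : 'cV[R]_m) (a : R) : Prop :=
  0 <= a /\ forall s : R, 0 <= s -> f (x + a *: d) <= f (x + s *: d).

Definition quadratic (R : realType) (m : nat) (A : 'M[R]_m) (b : 'cV[R]_m)
    (c : R) (x : 'cV[R]_m) : R :=
  2^-1 * (x^T *m A *m x) 0 0 + (b^T *m x) 0 0 + c.

(* Main.v *)
Require Import Defs.
From HB Require Import structures.
From mathcomp Require Import all_boot all_order all_algebra.
From mathcomp Require Import all_classical all_reals all_analysis.
From mathcomp Require Import ring.

Set Implicit Arguments.
Unset Strict Implicit.
Unset Printing Implicit Defensive.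

Import Order.TTheory GRing.Theory Num.Theory.
Import numFieldNormedType.Exports.

Local Open Scope ring_scope.

(** For a quadratic, the third derivatives vanish and the tangential part [w]
    of the affine normal vector solves [e_k^T A w = e_k^T A nu] for every
    tangent basis vector [e_k], where [nu] is the unit normal. Hence
    [A (w - nu)] is orthogonal to the tangent hyperplane, i.e.
    [A (w - nu) = l *: grad f x]; pairing with [w - nu] and using positive
    definiteness gives [l < 0]. So the affine normal direction is a positive
    multiple of the Newton direction [- A^-1 (grad f x)], whose ray contains
    the minimizer. *)

(** * Euclidean product and positive definite matrices *)

Lemma dotvC (R : realType) (m : nat) (u v : 'cV[R]_m) : dotv u v = dotv v u.
Proof. by rewrite /dotv -[u^T *m v]trmxK [LHS]mxE trmx_mul trmxK. Qed.

Lemma dotvv_sum (R : realType) (m : nat) (u : 'cV[R]_m) :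
  dotv u u = \sum_i u i 0 ^+ 2.
Proof. by rewrite /dotv mxE; apply: eq_bigr => i _; rewrite mxE expr2. Qed.

Lemma dotvv_ge0 (R : realType) (m : nat) (u : 'cV[R]_m) : 0 <= dotv u u.
Proof. by rewrite dotvv_sum sumr_ge0 // => i _; rewrite sqr_ge0. Qed.

Lemma dotvv_eq0 (R : realType) (m : nat) (u : 'cV[R]_m) :
  (dotv u u == 0) = (u == 0).
Proof.
apply/idP/eqP => [|->]; last by rewrite /dotv mulmx0 mxE.
rewrite dotvv_sum psumr_eq0 => [/allP u0|i _]; last exact: sqr_ge0.
apply/colP => i; apply/eqP.
by have := u0 i (mem_index_enum i); rewrite sqrf_eq0 mxE.
Qed.

Lemma enorm_gt0 (R : realType) (m : nat) (u : 'cV[R]_m) :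
  u != 0 -> 0 < enorm u.
Proof. by move=> u0; rewrite sqrtr_gt0 lt_def dotvv_eq0 u0 dotvv_ge0. Qed.

Lemma posdefmx_eq0 (R : realType) (m : nat) (A : 'M[R]_m) (u : 'cV[R]_m) :
  posdefmx A -> (u^T *m A *m u) 0 0 <= 0 -> u = 0.
Proof.
move=> Apos uAu; apply/eqP; apply: contraT => /Apos.
by rewrite ltNge uAu.
Qed.

(** A row vector [r] with [r *m A = 0] has quadratic form zero, so the left kernel is trivial. *)
Lemma posdefmx_unit (R : realType) (m : nat) (A : 'M[R]_m) :
  posdefmx A -> A \in unitmx.
Proof.
move=> Apos; rewrite -row_free_unit -kermx_eq0; apply/eqP/row_matrixP => i.
rewrite row0; apply: trmx_inj; rewrite trmx0.
by apply: (posdefmx_eq0 Apos); rewrite trmxK -row_mul mulmx_ker row0 mul0mx mxE.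
Qed.

(** The left inverse [E^T] makes [E] injective. With an orthonormal tangent basis as columns of [E],
    this covers the tangential Hessian. *)
Lemma posdefmx_congr (R : realType) (m n : nat) (A : 'M[R]_m)
    (E : 'M[R]_(m, n)) :
  posdefmx A -> E^T *m E = 1%:M -> posdefmx (E^T *m A *m E).
Proof.
move=> Apos EE u u0; have : E *m u != 0.
  by apply: contraNneq u0 => Eu0; rewrite -[u]mul1mx -EE -mulmxA Eu0 mulmx0.
by move/Apos; rewrite trmx_mul !mulmxA.
Qed.

(** * Derivatives of a quadratic *)

Lemma quadraticD (R : realType) (m : nat) (A : 'M[R]_m) (b : 'cV[R]_m) (c : R)
    (x z : 'cV[R]_m) : A^T = A ->
  quadratic A b c (x + z) =
  quadratic A b c x + dotv z (A *m x + b) + 2^-1 * (z^T *m A *m z) 0 0.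
Proof.
move=> Asym; rewrite /quadratic.
have -> : dotv z (A *m x + b) = (z^T *m A *m x) 0 0 + (b^T *m z) 0 0.
  rewrite -[(b^T *m z) 0 0]/(dotv b z) [dotv b z]dotvC.
  by rewrite /dotv mulmxDr mulmxA mxE.
have xAz : (x^T *m A *m z) 0 0 = (z^T *m A *m x) 0 0.
  by rewrite -mulmxA -[LHS]/(dotv x (A *m z)) dotvC /dotv trmx_mul Asym.
rewrite [(x + z)^T]linearD /= !mulmxDl !mulmxDr.
do 4 rewrite [(_ + _ : 'M[R]_(_, _)) 0 0]mxE.
by rewrite xAz; field.
Qed.

(** For nonzero [h] the difference quotient is exactly [l + h * k], which tends to [l]. Quadratic,
    affine and constant functions all have increments of this form, the last two with [k = 0]. *)
Lemma derive_of_increment (R : realType) (m : nat) (f : 'cV[R]_m -> R)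
    (x v : 'cV[R]_m) (l k : R) :
  (forall h : R, f (x + h *: v) = f x + h * (l + h * k)) -> 'D_v f x = l.
Proof.
move=> fE; apply: cvg_lim; first exact: Rhausdorff.
have : ((fun h : R => l + h * k) @ 0^' --> l + 0 * k)%classic.
  apply: cvg_within_filter.
  by apply: cvgD; [exact: cvg_cst|apply: cvgMl; exact: cvg_id].
rewrite mul0r addr0; apply: cvg_trans; apply: near_eq_cvg.
near=> h.
have h0 : h != 0 by near: h; exact: nbhs_dnbhs_neq.
by rewrite /= [h *: v + x]addrC fE [f x + _]addrC addrK /GRing.scale /= mulKf.
Unshelve. all: by end_near. Qed.

Lemma derive_quadratic (R : realType) (m : nat) (A : 'M[R]_m) (b : 'cV[R]_m)
    (c : R) (x v : 'cV[R]_m) : A^T = A ->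
  'D_v (quadratic A b c) x = dotv v (A *m x + b).
Proof.
move=> Asym.
apply: (@derive_of_increment _ _ _ _ _ _ (2^-1 * (v^T *m A *m v) 0 0)) => h.
rewrite quadraticD // /dotv [(h *: v)^T]linearZ /= -!scalemxAl -scalemxAr.
by rewrite ![(_ *: _ : 'M[R]_(_, _)) 0 0]mxE; ring.
Qed.

Lemma D2_quadratic (R : realType) (m : nat) (A : 'M[R]_m) (b : 'cV[R]_m)
    (c : R) (x u v : 'cV[R]_m) : A^T = A ->
  D2 (quadratic A b c) x u v = (v^T *m A *m u) 0 0.
Proof.
move=> Asym; rewrite /D2.
have -> : 'D_v (quadratic A b c) = fun y => dotv v (A *m y + b).
  by apply/funext => y; exact: derive_quadratic.
apply: (@derive_of_increment _ _ _ _ _ _ 0) => h; rewrite /dotv.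
rewrite !mulmxDr -!scalemxAr !mulmxA.
by rewrite ![(_ + _ : 'M[R]_(_, _)) 0 0]mxE [(_ *: _ : 'M[R]_(_, _)) 0 0]mxE; ring.
Qed.

Lemma D3_quadratic (R : realType) (m : nat) (A : 'M[R]_m) (b : 'cV[R]_m)
    (c : R) (x u v w : 'cV[R]_m) : A^T = A ->
  D3 (quadratic A b c) x u v w = 0.
Proof.
move=> Asym; rewrite /D3.
have -> : 'D_v ('D_w (quadratic A b c)) = fun=> (w^T *m A *m v) 0 0.
  by apply/funext => y; exact: D2_quadratic.
by apply: (@derive_of_increment _ _ _ _ _ _ 0) => h; ring.
Qed.

Lemma grad_quadratic (R : realType) (m : nat) (A : 'M[R]_m) (b : 'cV[R]_m)
    (c : R) (x : 'cV[R]_m) : A^T = A ->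
  grad (quadratic A b c) x = A *m x + b.
Proof.
move=> Asym; apply/colP => i.
by rewrite [LHS]mxE derive_quadratic // /dotv trmx_delta -rowE mxE.
Qed.

(** * Orthonormal bases of the tangent hyperplane in matrix form *)

Definition cols_mx (R : realType) (m n : nat) (e : n.-tuple 'cV[R]_m) :
    'M[R]_(m, n) :=
  \matrix_(i, j) tnth e j i 0.

Lemma mulmx_cols_mxE (R : realType) (m n p : nat) (e : n.-tuple 'cV[R]_m)
    (B : 'M[R]_(p, m)) (i : 'I_p) (j : 'I_n) :
  (B *m cols_mx e) i j = (B *m tnth e j) i 0.
Proof. by rewrite !mxE; apply: eq_bigr => k _; rewrite mxE. Qed.

Lemma mul_cols_mx (R : realType) (m n : nat) (e : n.-tuple 'cV[R]_m)
    (v : 'cV[R]_n) : cols_mx e *m v = \sum_i v i 0 *: tnth e i.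
Proof.
apply/colP => k; rewrite mxE summxE; apply: eq_bigr => i _.
by rewrite !mxE mulrC.
Qed.

Lemma tr_cols_mx_mul (R : realType) (m n : nat) (e : n.-tuple 'cV[R]_m)
    (v : 'cV[R]_m) (j : 'I_n) :
  ((cols_mx e)^T *m v) j 0 = dotv (tnth e j) v.
Proof. by rewrite /dotv !mxE; apply: eq_bigr => i _; rewrite !mxE. Qed.

Lemma mem_perp (R : realType) (m : nat) (g v : 'cV[R]_m) :
  (v \in perp g) = (g^T *m v == 0).
Proof. by rewrite memv_ker lfunE. Qed.

Section OrthonormalBasis.
Context (R : realType) (m n : nat) (g : 'cV[R]_m) (e : n.-tuple 'cV[R]_m).
Hypothesis onb : orthonormal_basis (perp g) e.
Let E := cols_mx e.

Lemma orthonormal_cols_mx : E^T *m E = 1%:M.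
Proof.
apply/matrixP => i j; rewrite [RHS]mxE -(proj2 onb i j) -tr_cols_mx_mul.
exact: mulmx_cols_mxE.
Qed.

Lemma mul_normal_cols_mx : g^T *m E = 0.
Proof.
apply/matrixP => i j; rewrite mulmx_cols_mxE.
have : tnth e j \in perp g by rewrite (basis_mem onb.1) // mem_tnth.
by rewrite mem_perp => /eqP ->; rewrite !mxE.
Qed.

Lemma perp_cols_mx (v : 'cV[R]_m) :
  g^T *m v = 0 -> exists u : 'cV[R]_n, v = E *m u.
Proof.
move=> /eqP; rewrite -mem_perp => vg; exists (\col_i coord e i v).
rewrite mul_cols_mx [LHS](coord_basis onb.1 vg).
by apply: eq_bigr => i _; rewrite mxE (tnth_nth 0).
Qed.

(** The double orthogonal complement of [g] is its line. Removing from [v] its projection on [g]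
    leaves [z] both in the hyperplane, [z = E *m u], and orthogonal to it, so [dotv z z = 0]. *)
Lemma orthogonal_cols_mx (v : 'cV[R]_m) :
  g != 0 -> E^T *m v = 0 -> exists l : R, v = l *: g.
Proof.
move=> g0 Ev; exists (dotv g v / dotv g g); apply/eqP; rewrite -subr_eq0.
set l := _ / _; set z := v - _.
have gz : g^T *m z = 0.
  apply/matrixP => i j; rewrite !ord1 mulmxBr -scalemxAr.
  rewrite [LHS]mxE [(- _ : 'M[R]_(_, _)) _ _]mxE.
  rewrite [(_ *: _ : 'M[R]_(_, _)) _ _]mxE [RHS]mxE.
  by rewrite -/(dotv g v) -/(dotv g g) divfK ?dotvv_eq0 // subrr.
have Ez : E^T *m z = 0.
  rewrite mulmxBr Ev -scalemxAr -[E^T *m g]trmxK trmx_mul trmxK.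
  by rewrite mul_normal_cols_mx trmx0 scaler0 subr0.
have [u zE] := perp_cols_mx gz.
by rewrite -dotvv_eq0 /dotv {1}zE trmx_mul -mulmxA Ez mulmx0 mxE.
Qed.
End OrthonormalBasis.

(** * The affine normal direction of a quadratic *)

Lemma affine_normal_vector_quadratic (R : realType) (n : nat)
    (A : 'M[R]_n.+1) (b : 'cV[R]_n.+1) (c : R) (x : 'cV[R]_n.+1)
    (e : n.-tuple 'cV[R]_n.+1) : A^T = A ->
  let E := cols_mx e in let nu := unit_normal (quadratic A b c) x in
  affine_normal_vector (quadratic A b c) x e =
  E *m (invmx (E^T *m A *m E) *m (E^T *m A *m nu)) - nu.
Proof.
move=> Asym E nu; rewrite /affine_normal_vector -/nu; congr (_ - _).
have -> : tangent_hessian (quadratic A b c) x e = E^T *m A *m E.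
  (* [D2_quadratic] puts the first direction on the right; symmetry of [A] restores the order of the
     indices. *)
  apply/matrixP => i j; rewrite mxE D2_quadratic // -{1}Asym -trmx_mul.
  by rewrite -[LHS]/(dotv _ _) dotvC -tr_cols_mx_mul mulmxA mulmx_cols_mxE.
rewrite mul_cols_mx; apply: eq_bigr => i _; congr (_ *: _).
rewrite mxE; apply: eq_bigr => j _; congr (_ * _).
rewrite big1 => [|p _]; last first.
  by apply: big1 => q _; rewrite D3_quadratic // mulr0.
by rewrite mulr0 add0r D2_quadratic // -!mulmxA tr_cols_mx_mul.
Qed.

Lemma affine_normal_direction_newton (R : realType) (n : nat)
    (A : 'M[R]_n.+1) (b : 'cV[R]_n.+1) (c : R) (x d : 'cV[R]_n.+1) :
  A^T = A -> posdefmx A -> grad (quadratic A b c) x != 0 ->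
  affine_normal_direction (quadratic A b c) x d ->
  exists2 k : R, 0 < k & A *m d = - k *: grad (quadratic A b c) x.
Proof.
move=> Asym Apos g0 [e [t [onb t_gt0 ->]]].
rewrite affine_normal_vector_quadratic //.
set E := cols_mx e; rewrite /unit_normal; set g := grad _ _ in g0 onb *.
set N := enorm g; set nu := N^-1 *: g.
set u := invmx _ *m _; set D := _ - _.
have N_gt0 : 0 < N by exact: enorm_gt0.
(* This makes [invmx] a genuine inverse here, not its default value. *)
have Hunit : E^T *m A *m E \in unitmx.
  exact/posdefmx_unit/posdefmx_congr/(orthonormal_cols_mx onb).
have EAD : E^T *m (A *m D) = 0.
  by rewrite !mulmxBr !mulmxA mulmxV // mul1mx subrr.
have [l ADE] := orthogonal_cols_mx onb g0 EAD.
(* The tangential part of [D] is orthogonal to [g]; only [- nu] contributes. *)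
have gD : dotv D g = - (N^-1 * dotv g g).
  rewrite dotvC /dotv mulmxBr mulmxA (mul_normal_cols_mx onb).
  by rewrite mul0mx sub0r -scalemxAr !mxE.
have gg : 0 < dotv g g by rewrite lt_def dotvv_eq0 g0 dotvv_ge0.
have D0 : D != 0.
  apply: contraTneq gg => D0; move: gD; rewrite D0 /dotv trmx0 mul0mx mxE.
  move/eqP; rewrite eq_sym oppr_eq0 mulf_eq0 invr_eq0 (gt_eqF N_gt0) /=.
  by move/eqP => ->; rewrite ltxx.
(* The form of [A] at [D] is positive and equals [l * dotv D g], whose second factor is negative. *)
have l_lt0 : l < 0.
  have := Apos D D0; rewrite -mulmxA ADE -scalemxAr mxE -/(dotv D g) gD.
  by rewrite mulrN oppr_gt0 pmulr_llt0 // mulr_gt0 // invr_gt0.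
exists (- (t * l)); first by rewrite oppr_gt0 pmulr_rlt0.
by rewrite opprK -scalemxAr ADE scalerA.
Qed.

Unset Implicit Arguments.
Set Strict Implicit.
Set Printing Implicit Defensive.

Theorem corollary3p2 (R : realType) (n : nat) (hn : (1 <= n)%N)
    (A : 'M[R]_n.+1) (b : 'cV[R]_n.+1) (c : R)
    (hAsym : A^T = A) (hApos : posdefmx A)
    (x : 'cV[R]_n.+1) (hx : grad (quadratic A b c) x != 0)
    (d : 'cV[R]_n.+1) (hd : affine_normal_direction (quadratic A b c) x d)
    (a : R) (ha : exact_line_search (quadratic A b c) x d a) :
  x + a *: d = - (invmx A *m b).
Proof.
have [k k_gt0 Ad] := affine_normal_direction_newton hAsym hApos hx hd.
have Aunit := posdefmx_unit hApos.
(* The Newton step: [k^-1] is the parameter at which the ray meets the minimizer. *)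
have xsE : x + k^-1 *: d = - (invmx A *m b).
  apply: (can_inj (mulKmx Aunit)); rewrite mulmxN mulKVmx // mulmxDr.
  rewrite -scalemxAr Ad scalerA mulrN mulVf ?gt_eqF // scaleN1r.
  by rewrite grad_quadratic // opprD addNKr.
set xs := - _ in xsE *.
have Axs : A *m xs + b = 0 by rewrite mulmxN mulKVmx // addNr.
apply/eqP; rewrite -subr_eq0; apply/eqP; apply: (posdefmx_eq0 hApos).
have k1_ge0 : 0 <= k^-1 by rewrite invr_ge0 ltW.
(* Comparing with the parameter [k^-1] bounds the value at [x + a *: d] by the minimum. Expanded
   around [xs], where the gradient vanishes, this says that the form of [A] at [x + a *: d - xs] is
   at most zero. *)
have := ha.2 _ k1_ge0; rewrite xsE -{1}[x + _](subrKC xs) quadraticD // Axs.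
rewrite {1}/dotv mulmx0 mxE addr0 gerDl pmulr_rle0 // invr_gt0.
Qed.
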